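(* Let $P\subset\mathbb{R}^d$ be a $d$-dimensional convex lattice polytope, let $k$ be a positive integer and let $\zeta\in\mathbb{C}$ be a primitive $k$-th root of unity. Then $$\mathrm{Ehr}_{kP}(z)=\frac1k\sum_{i=0}^{k-1}\mathrm{Ehr}_P\big(\zeta^i z^{1/k}\big),$$ that is, writing $w=z^{1/k}$ for a formal $k$-th root of $z$, the identity $\mathrm{Ehr}_{kP}(w^k)=\frac1k\sum_{i=0}^{k-1}\mathrm{Ehr}_P(\zeta^i w)$ holds in the ring of formal power series $\mathbb{C}[[w]]$.
   Context: A $d$-dimensional convex lattice polytope is a convex polytope $P\subset\mathbb{R}^d$ with $\dim P=d$, all of whose vertices lie in $\mathbb{Z}^d$. Let $\mathrm{G}_P(k)=\#(kP\cap\mathbb{Z}^d)$ for integers $k\ge0$ (so $\mathrm{G}_P(0)=1$). The Ehrhart series of $P$ is the formal power series $\mathrm{Ehr}_P(z)=\sum_{k\ge0}\mathrm{G}_P(k)z^k$. *)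

(* Defs.v *)
From HB Require Import structures.
From mathcomp Require Import all_boot all_order all_algebra finmap.
From mathcomp Require Import boolp classical_sets cardinality reals.
From mathcomp Require Import complex.

Set Implicit Arguments.
Unset Strict Implicit.
Unset Printing Implicit Defensive.

Import Order.TTheory GRing.Theory Num.Theory.

Local Open Scope classical_set_scope.
Local Open Scope ring_scope.

Record fps (K : Type) := Fps { fcoef : nat -> K }.

Lemma fpsP (K : Type) (f g : fps K) :
  (forall n, fcoef f n = fcoef g n) <-> f = g.
Proof.
split=> [|->//]; case: f g => [f] [g] /= h.
by congr Fps; apply/funext.
Qed.

HB.instance Definition _ (K : Type) := gen_eqMixin (fps K).
HB.instance Definition _ (K : Type) := gen_choiceMixin (fps K).

Section FpsRing.
Variable K : comNzRingType.
Implicit Types f g h : fps K.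

Definition fps_zero : fps K := Fps (fun=> 0).
Definition fps_opp f : fps K := Fps (fun n => - fcoef f n).
Definition fps_add f g : fps K := Fps (fun n => fcoef f n + fcoef g n).
Definition fps_one : fps K := Fps (fun n => (n == 0%N)%:R).
Definition fps_mul f g : fps K :=
  Fps (fun n => \sum_(j < n.+1) fcoef f j * fcoef g (n - j)%N).
Definition fps_scale (a : K) f : fps K := Fps (fun n => a * fcoef f n).

Fact fps_addA : associative fps_add.
Proof. by move=> f g h; apply/fpsP => n /=; rewrite addrA. Qed.
Fact fps_addC : commutative fps_add.
Proof. by move=> f g; apply/fpsP => n /=; rewrite addrC. Qed.
Fact fps_add0 : left_id fps_zero fps_add.
Proof. by move=> f; apply/fpsP => n /=; rewrite add0r. Qed.
Fact fps_addN : left_inverse fps_zero fps_opp fps_add.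
Proof. by move=> f; apply/fpsP => n /=; rewrite addNr. Qed.

HB.instance Definition _ := GRing.isZmodule.Build (fps K)
  fps_addA fps_addC fps_add0 fps_addN.

(* The ring axioms are transferred from {poly K} by truncation. *)
Let trunc (N : nat) f : {poly K} := \poly_(i < N) fcoef f i.

Let coef_trunc_mul N f g n : (n < N)%N ->
  (trunc N f * trunc N g)`_n = fcoef (fps_mul f g) n.
Proof.
move=> ltnN; rewrite coefM /=; apply: eq_bigr => j _.
by rewrite !coef_poly (leq_ltn_trans _ ltnN) ?(leq_ltn_trans _ ltnN) ?leq_subr
  // -ltnS.
Qed.

Let coef_mul_congr (p p' q q' : {poly K}) n :
  (forall i, (i <= n)%N -> p`_i = p'`_i) ->
  (forall i, (i <= n)%N -> q`_i = q'`_i) -> (p * q)`_n = (p' * q')`_n.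
Proof.
move=> hp hq; rewrite !coefM; apply: eq_bigr => j _.
by rewrite hp ?hq ?leq_subr // -ltnS.
Qed.

Let coef_trunc_mulE N f g i : (i < N)%N ->
  (trunc N (fps_mul f g))`_i = (trunc N f * trunc N g)`_i.
Proof. by move=> h; rewrite coef_trunc_mul // coef_poly h. Qed.

Fact fps_mulA : associative fps_mul.
Proof.
move=> f g h; apply/fpsP => n.
rewrite -!(@coef_trunc_mul n.+1) //.
rewrite (@coef_mul_congr _ (trunc n.+1 f) _ (trunc n.+1 g * trunc n.+1 h)) //;
  last by move=> i ?; rewrite coef_trunc_mulE.
rewrite mulrA; apply/esym/coef_mul_congr => // i ?.
by rewrite coef_trunc_mulE.
Qed.

Fact fps_mulC : commutative fps_mul.
Proof. by move=> f g; apply/fpsP=> n; rewrite -!(@coef_trunc_mul n.+1) // mulrC. Qed.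

Fact fps_mul1 : left_id fps_one fps_mul.
Proof.
move=> f; apply/fpsP => n /=.
by rewrite big_ord_recl subn0 mul1r big1 ?addr0 // => i _; rewrite mul0r.
Qed.

Fact fps_mulDl : left_distributive fps_mul fps_add.
Proof.
move=> f g h; apply/fpsP => n /=; rewrite -big_split /=.
by apply: eq_bigr => i _; rewrite mulrDl.
Qed.

Fact fps_one_neq0 : fps_one != 0.
Proof.
by apply/eqP => /fpsP /(_ 0%N) /= /eqP; rewrite oner_eq0.
Qed.

HB.instance Definition _ := GRing.Zmodule_isComNzRing.Build (fps K)
  fps_mulA fps_mulC fps_mul1 fps_mulDl fps_one_neq0.

Fact fps_scaleA a b f : fps_scale a (fps_scale b f) = fps_scale (a * b) f.
Proof. by apply/fpsP => n /=; rewrite mulrA. Qed.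
Fact fps_scale1 : left_id 1 fps_scale.
Proof. by move=> f; apply/fpsP => n /=; rewrite mul1r. Qed.
Fact fps_scaleDr : right_distributive fps_scale +%R.
Proof. by move=> a f g; apply/fpsP => n /=; rewrite mulrDr. Qed.
Fact fps_scaleDl f : {morph fps_scale^~ f : a b / a + b}.
Proof. by move=> a b; apply/fpsP => n /=; rewrite mulrDl. Qed.

HB.instance Definition _ := GRing.Zmodule_isLmodule.Build K (fps K)
  fps_scaleA fps_scale1 fps_scaleDr fps_scaleDl.

Fact fps_scaleAl (a : K) f g : a *: (f * g) = (a *: f) * g.
Proof.
apply/fpsP => n /=; rewrite mulr_sumr.
by apply: eq_bigr => i _; rewrite mulrA.
Qed.

HB.instance Definition _ := GRing.Lmodule_isLalgebra.Build K (fps K)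
  fps_scaleAl.
HB.instance Definition _ := GRing.Lalgebra_isComAlgebra.Build K (fps K).

Definition fpsX : fps K := Fps (fun n => (n == 1%N)%:R).

(* The substitution f(g) = \sum_j f_j g^j, meaningful when g has zero constant
   term: then g ^+ j has no term of degree n as soon as j > n. *)
Definition fps_comp f g : fps K :=
  Fps (fun n => \sum_(j < n.+1) fcoef f j * fcoef (g ^+ j) n).

End FpsRing.

Arguments fpsX {K}.

Section Polytopes.
Variables (R : realType) (d : nat).
Implicit Types (P A F : set 'rV[R]_d) (x v : 'rV[R]_d).

Definition convex_hull A : set 'rV[R]_d :=
  [set x | exists n (p : 'I_n -> 'rV[R]_d) (a : 'I_n -> R),
     [/\ forall i, A (p i), forall i, 0 <= a i, \sum_i a i = 1
       & x = \sum_i a i *: p i]].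

Definition affine_hull A : set 'rV[R]_d :=
  [set x | exists n (p : 'I_n -> 'rV[R]_d) (a : 'I_n -> R),
     [/\ forall i, A (p i), \sum_i a i = 1 & x = \sum_i a i *: p i]].

(* dim P = n, for nonempty P; the empty set has no dimension in this sense. *)
Definition has_dim P (n : nat) : Prop :=
  exists x (V : {vspace 'rV[R]_d}),
    affine_hull P = [set x + v | v in [set v | v \in V]] /\ (\dim V)%VS = n.

Definition convex_polytope P : Prop :=
  exists A, finite_set A /\ P = convex_hull A.

(* F is cut out of P by equality in a linear inequality valid on P. *)
Definition face P F : Prop :=
  exists (c : 'rV[R]_d) (b : R),
    (forall x, P x -> \sum_i c 0 i * x 0 i <= b) /\
    F = [set x | P x /\ \sum_i c 0 i * x 0 i = b].

Definition vertex P v : Prop := face P [set v].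

Definition lattice : set 'rV[R]_d :=
  [set x | forall i, x 0 i \is a Num.int].

Definition lattice_polytope P : Prop :=
  convex_polytope P /\ (forall v, vertex P v -> lattice v).

Definition dilate (k : nat) P : set 'rV[R]_d := [set k%:R *: x | x in P].

(* fset_set of an infinite set is empty by convention; polytopes are bounded,
   so this case does not arise for them. *)
Definition lattice_count P (k : nat) : nat :=
  #|` fset_set (dilate k P `&` lattice)|%fset.

Definition Ehr P : fps R[i] := Fps (fun k => (lattice_count P k)%:R).

End Polytopes.

(* Main.v *)
Require Import Defs.
From HB Require Import structures.
From mathcomp Require Import all_boot all_order all_algebra finmap.
From mathcomp Require Import boolp classical_sets cardinality reals.
From mathcomp Require Import complex.

Set Implicit Arguments.
Unset Strict Implicit.
Unset Printing Implicit Defensive.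

Import Order.TTheory GRing.Theory Num.Theory.
Local Open Scope classical_set_scope.
Local Open Scope ring_scope.

(** Dilating by k and then by m is dilating by mk, so Ehr_(kP) has as
    coefficients those of Ehr_P at the multiples of k, and substituting w^k
    returns each of them to its original degree.  The left-hand side is thus
    Ehr_P with the terms w^n such that k does not divide n deleted.  The
    right-hand side is the roots-of-unity filter for the same operation:
    averaging f(zeta^i w) over i multiplies the n-th coefficient of f by the
    average of the powers (zeta^n)^i, which is 1 when k divides n and 0
    otherwise.  The geometric half is [Ehr_dilate]; the filter is
    [fps_multisection], which holds for every power series over a field. *)

Section Coefficients.
Variable K : comNzRingType.

Lemma fcoef_sum (I : Type) (s : seq I) (F : I -> fps K) n :
  fcoef (\sum_(i <- s) F i) n = \sum_(i <- s) fcoef (F i) n.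
Proof. by apply: (big_morph (fun f : fps K => fcoef f n)). Qed.

Lemma fcoef_fpsX_mul (f : fps K) n :
  fcoef (fpsX * f) n = if n is m.+1 then fcoef f m else 0.
Proof.
rewrite /= big_ord_recl /= mul0r add0r; case: n => [|m]; first by rewrite big_ord0.
rewrite big_ord_recl /= mul1r subn1 big1 ?addr0 // => j _.
by rewrite mul0r.
Qed.

Lemma fcoef_fpsXn j n : fcoef (fpsX ^+ j : fps K) n = (n == j)%:R.
Proof.
elim: j n => [|j IHj] n; first by rewrite expr0.
by rewrite exprS fcoef_fpsX_mul; case: n => [|n] //; rewrite IHj.
Qed.

Lemma fcoef_comp_scaleX (f : fps K) (a : K) n :
  fcoef (fps_comp f (a *: fpsX)) n = fcoef f n * a ^+ n.
Proof.
rewrite /= big_ord_recr /= big1 ?add0r => [|j _];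
  rewrite exprZn /= fcoef_fpsXn; first by rewrite eqxx mulr1.
by rewrite gtn_eqF ?mulr0 // ltn_ord.
Qed.

Lemma fcoef_comp_Xn (f : fps K) k n : (0 < k)%N ->
  fcoef (fps_comp f (fpsX ^+ k)) n = if (k %| n)%N then fcoef f (n %/ k) else 0.
Proof.
move=> k_gt0 /=.
under eq_bigr => j _ do rewrite -exprM fcoef_fpsXn.
case: ifPn => [/dvdnP[m ->]|ndiv].
  (* m <= m * k, so the one contributing index m is in the truncated range. *)
  have lt_m : (m < (m * k).+1)%N by rewrite ltnS leq_pmulr.
  rewrite mulnK // (bigD1 (Ordinal lt_m)) //= [(k * m)%N]mulnC eqxx mulr1.
  rewrite big1 ?addr0 // => j; rewrite -val_eqE /= eq_sym => ne_mj.
  by rewrite [(k * j)%N]mulnC eqn_pmul2r // (negbTE ne_mj) mulr0.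
rewrite big1 // => j _; case: eqP => [def_n|_]; last by rewrite mulr0.
by rewrite def_n dvdn_mulr in ndiv.
Qed.

End Coefficients.

(** The sum is a geometric progression of ratio zeta^n, a k-th root of unity:
    the ratio is 1 exactly when k divides n, and otherwise the identity
    x^k - 1 = (x - 1)(1 + ... + x^(k-1)) makes the sum vanish. *)
Lemma sum_prim_root_pow (F : fieldType) k (zeta : F) n :
  k.-primitive_root zeta ->
  \sum_(i < k) (zeta ^+ i) ^+ n = if (k %| n)%N then k%:R else 0.
Proof.
move=> zetaP; under eq_bigr => i _ do rewrite exprAC.
rewrite (prim_order_dvd zetaP); case: eqP => [->|/eqP ne1].
  under eq_bigr => i _ do rewrite expr1n.
  by rewrite sumr_const card_ord.
apply: (mulfI (x := zeta ^+ n - 1)); first by rewrite subr_eq0.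
by rewrite -subrX1 exprAC (prim_expr_order zetaP) expr1n subrr mulr0.
Qed.

(** The roots-of-unity filter: both sides are f restricted to the degrees
    divisible by k.  Dividing by k is legitimate in any characteristic, since a
    primitive k-th root of unity exists only where k is invertible. *)
Lemma fps_multisection (F : fieldType) (f : fps F) k (zeta : F) :
  (0 < k)%N -> k.-primitive_root zeta ->
  fps_comp (Fps (fun m => fcoef f (m * k)%N)) (fpsX ^+ k) =
  k%:R^-1 *: \sum_(i < k) fps_comp f (zeta ^+ i *: fpsX).
Proof.
move=> k_gt0 zetaP; apply/fpsP => n.
rewrite fcoef_comp_Xn // [RHS]/= fcoef_sum.
under eq_bigr => i _ do rewrite fcoef_comp_scaleX.
rewrite -mulr_sumr (sum_prim_root_pow n zetaP).
case: ifPn => [/divnK def_n|_]; last by rewrite !mulr0.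
by rewrite /= def_n mulrC mulfK // (prim_root_natf_neq0 zetaP).
Qed.

Lemma dilateM (R : realType) (d : nat) (P : set 'rV[R]_d) m k :
  dilate m (dilate k P) = dilate (m * k) P.
Proof.
rewrite /dilate image_comp; congr image; apply/funext => x /=.
by rewrite scalerA natrM.
Qed.

Lemma Ehr_dilate (R : realType) (d : nat) (P : set 'rV[R]_d) k :
  Ehr (dilate k P) = Fps (fun m => fcoef (Ehr P) (m * k)%N).
Proof. by apply/fpsP => m; rewrite /= /lattice_count dilateM. Qed.

Theorem lemma1p5 (R : realType) (d : nat) (P : set 'rV[R]_d)
    (hP : lattice_polytope P) (hdim : has_dim P d)
    (k : nat) (hk : (0 < k)%N)
    (zeta : R[i]) (hzeta : k.-primitive_root zeta) :
  fps_comp (Ehr (dilate k P)) (fpsX ^+ k) =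
  k%:R^-1 *: \sum_(i < k) fps_comp (Ehr P) (zeta ^+ i *: fpsX).
Proof. by rewrite Ehr_dilate; apply: fps_multisection. Qed.
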